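(* Let $N\geq 1$ and $a=X_0<X_1<\dots<X_N=b$, and let $\Omega_i=[X_i,X_{i+1}]$ for $0\leq i\leq N-1$. For differentiable functions $u_i:\Omega_i\to\mathbb{R}$ ($0\leq i\leq N-1$) consider the $C^1$ continuity conditions $$(\ast)\qquad u_i(X_{i+1})=u_{i+1}(X_{i+1}),\qquad u_i'(X_{i+1})=u_{i+1}'(X_{i+1}),\qquad 0\leq i\leq N-2,$$ and the expressions, for $x\in\Omega_i$ and $0\leq i\leq N-1$, $$(\ast\ast)\qquad \begin{aligned}u_i(x)=\ &g_i(x)+[\alpha_i-g_i(X_i)]\psi_0(X_i,X_{i+1},x)+[\alpha_{i+1}-g_i(X_{i+1})]\psi_1(X_i,X_{i+1},x)\\&+[\beta_i-g_i'(X_i)]\varphi_0(X_i,X_{i+1},x)+[\beta_{i+1}-g_i'(X_{i+1})]\varphi_1(X_i,X_{i+1},x).\end{aligned}$$ (i) For arbitrary (differentiable) functions $g_i:\Omega_i\to\mathbb{R}$ ($0\leq i\leq N-1$) and arbitrary values of the parameters $\alpha_i,\beta_i\in\mathbb{R}$ ($0\leq i\leq N$), the functions $u_i$ given by $(\ast\ast)$ satisfy $(\ast)$. (ii) Any set of functions $u_i$ ($0\leq i\leq N-1$) satisfying $(\ast)$ can be expressed in the form $(\ast\ast)$ for some (differentiable) $g_i$ ($0\leq i\leq N-1$) and some values of the parameters $(\alpha_i,\beta_i)$ ($0\leq i\leq N$).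
   Context: For real numbers $s<t$ set $\phi_0(s,t,x)=\dfrac{t-x}{t-s}$, $\phi_1(s,t,x)=\dfrac{x-s}{t-s}$, and (writing $\phi_k=\phi_k(s,t,x)$, with $\phi_k'$ its derivative in $x$) $$\psi_0(s,t,x)=3\phi_0^2-2\phi_0^3,\quad \psi_1(s,t,x)=3\phi_1^2-2\phi_1^3,$$ $$\varphi_0(s,t,x)=\left[\phi_0'|_{x=s}\right]^{-1}\left(\phi_0^3-\phi_0^2\right),\quad \varphi_1(s,t,x)=\left[\phi_1'|_{x=t}\right]^{-1}\left(\phi_1^3-\phi_1^2\right).$$ Derivatives at the endpoints of an interval are one-sided. *)

(* Defs.v *)
From Stdlib Require Import Reals Lra.
From Coquelicot Require Import Coquelicot.
Open Scope R_scope.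

Definition phi0 (s t x : R) : R := (t - x) / (t - s).
Definition phi1 (s t x : R) : R := (x - s) / (t - s).

Definition psi0 (s t x : R) : R := 3 * phi0 s t x ^ 2 - 2 * phi0 s t x ^ 3.
Definition psi1 (s t x : R) : R := 3 * phi1 s t x ^ 2 - 2 * phi1 s t x ^ 3.

Definition varphi0 (s t x : R) : R :=
  / Derive (phi0 s t) s * (phi0 s t x ^ 3 - phi0 s t x ^ 2).
Definition varphi1 (s t x : R) : R :=
  / Derive (phi1 s t) t * (phi1 s t x ^ 3 - phi1 s t x ^ 2).

(** A function on an interval is represented by a total function [R -> R] whose
    values outside the interval are irrelevant. [D_in f d D x] says that the
    difference quotient of [f] at [x] tends to [d x] along [D] minus [x]; for [D]
    a closed interval this is the ordinary derivative at interior points and the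
    one-sided derivative at the endpoints. *)
Definition is_derive_in (D : R -> Prop) (f : R -> R) (x l : R) : Prop :=
  D_in f (fun _ => l) D x.

Definition differentiable_on (D : R -> Prop) (f : R -> R) : Prop :=
  forall x, D x -> exists l, is_derive_in D f x l.

(** Meaningful only when [f] has a derivative within [D] at [x]; see
    [derive_in_unique]. *)
Definition derive_in (D : R -> Prop) (f : R -> R) (x : R) : R :=
  iota (is_derive_in D f x).

Definition Omega (X : nat -> R) (i : nat) : R -> Prop :=
  fun x => X i <= x <= X (i + 1)%nat.

Definition C1_conditions (N : nat) (X : nat -> R) (u : nat -> R -> R) : Prop :=
  forall i, (i + 1 < N)%nat ->
    u i (X (i + 1)%nat) = u (i + 1)%nat (X (i + 1)%nat) /\
    derive_in (Omega X i) (u i) (X (i + 1)%nat) =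
    derive_in (Omega X (i + 1)) (u (i + 1)%nat) (X (i + 1)%nat).

Definition hermite_form (N : nat) (X : nat -> R) (g : nat -> R -> R)
    (alpha beta : nat -> R) (u : nat -> R -> R) : Prop :=
  forall i x, (i < N)%nat -> Omega X i x ->
    u i x =
      g i x
      + (alpha i - g i (X i)) * psi0 (X i) (X (i + 1)%nat) x
      + (alpha (i + 1)%nat - g i (X (i + 1)%nat)) * psi1 (X i) (X (i + 1)%nat) x
      + (beta i - derive_in (Omega X i) (g i) (X i))
          * varphi0 (X i) (X (i + 1)%nat) x
      + (beta (i + 1)%nat - derive_in (Omega X i) (g i) (X (i + 1)%nat))
          * varphi1 (X i) (X (i + 1)%nat) x.

Lemma derive_in_unique (a b : R) (f : R -> R) (x l : R) :
  a < b -> a <= x <= b ->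
  is_derive_in (fun y => a <= y <= b) f x l ->
  derive_in (fun y => a <= y <= b) f x = l.
Proof.
intros hab hx Hl.
apply (iota_unique (V := R_CompleteNormedModule)); [| exact Hl].
intros m Hm.
refine (single_limit _ _ _ _ _ _ Hm Hl).
intros eps he.
pose (d := Rmin (eps / 2) ((b - a) / 2)).
assert (0 < d) by (apply Rmin_pos; lra).
assert (d <= eps / 2) by apply Rmin_l.
assert (d <= (b - a) / 2) by apply Rmin_r.
destruct (Rle_dec x ((a + b) / 2)) as [h | h];
  [exists (x + d) | exists (x - d)]; (split; [split; lra |]);
  simpl; unfold Rdist; apply Rabs_def1; lra.
Qed.

(* Main.v *)
Require Import Defs.
From Stdlib Require Import Reals Lra Lia.
From Coquelicot Require Import Coquelicot.
Open Scope R_scope.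

(** On an interval with endpoints [s < t], the four cubics [psi0], [psi1],
    [varphi0], [varphi1] form the Hermite basis: the combination with
    coefficients [A], [B], [C], [E] takes the values [A], [B] and has the
    derivatives [C], [E] at [s], [t] ([hermite_interp_left],
    [hermite_interp_right], [is_derive_hermite_interp_left],
    [is_derive_hermite_interp_right]).

    Adding to [g] the combination whose coefficients are [A - g s], [B - g t],
    [C - g' s], [E - g' t] therefore yields a function with prescribed values
    and one-sided derivatives at both endpoints, whatever [g] is
    ([hermite_correction]).  For the first claim, the two pieces meeting at an
    interior node receive the same data there, hence join in a C^1 way.

    For the second claim take [g i = u i], and let [alpha] and [beta] be the
    nodal values and derivatives of the [u i]; by the continuity conditions these
    do not depend on which of the two adjacent pieces is used, so every bracket
    in the Hermite form vanishes. *)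

(** * The cubic Hermite interpolant *)

(** The cubic taking the values [A], [B] and having the slopes [C], [E] at [s]
    and [t]. *)
Definition hermite_interp (s t A B C E x : R) : R :=
  A * psi0 s t x + B * psi1 s t x + C * varphi0 s t x + E * varphi1 s t x.

Lemma Derive_phi0 (s t x : R) : s < t -> Derive (phi0 s t) x = - / (t - s).
Proof.
intros hst; apply is_derive_unique; unfold phi0.
auto_derive; [lra | field; lra].
Qed.

Lemma Derive_phi1 (s t x : R) : s < t -> Derive (phi1 s t) x = / (t - s).
Proof.
intros hst; apply is_derive_unique; unfold phi1.
auto_derive; [lra | field; lra].
Qed.

Lemma hermite_interpE (s t A B C E x : R) : s < t ->
  hermite_interp s t A B C E x =
    A * (3 * ((t - x) / (t - s)) ^ 2 - 2 * ((t - x) / (t - s)) ^ 3)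
    + B * (3 * ((x - s) / (t - s)) ^ 2 - 2 * ((x - s) / (t - s)) ^ 3)
    - C * (t - s) * (((t - x) / (t - s)) ^ 3 - ((t - x) / (t - s)) ^ 2)
    + E * (t - s) * (((x - s) / (t - s)) ^ 3 - ((x - s) / (t - s)) ^ 2).
Proof.
intros hst; unfold hermite_interp, psi0, psi1, varphi0, varphi1.
rewrite Derive_phi0, Derive_phi1 by assumption.
unfold phi0, phi1; field; lra.
Qed.

Lemma hermite_interp_left (s t A B C E : R) : s < t ->
  hermite_interp s t A B C E s = A.
Proof. intros hst; rewrite hermite_interpE by assumption; field; lra. Qed.

Lemma hermite_interp_right (s t A B C E : R) : s < t ->
  hermite_interp s t A B C E t = B.
Proof. intros hst; rewrite hermite_interpE by assumption; field; lra. Qed.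

Lemma ex_derive_hermite_interp (s t A B C E x : R) : s < t ->
  ex_derive (hermite_interp s t A B C E) x.
Proof.
intros hst.
eapply ex_derive_ext;
  [intros y; symmetry; apply hermite_interpE, hst |].
auto_derive; lra.
Qed.

Lemma is_derive_hermite_interp_left (s t A B C E : R) : s < t ->
  is_derive (hermite_interp s t A B C E) s C.
Proof.
intros hst.
eapply is_derive_ext;
  [intros y; symmetry; apply hermite_interpE, hst |].
auto_derive; [lra | field; lra].
Qed.

Lemma is_derive_hermite_interp_right (s t A B C E : R) : s < t ->
  is_derive (hermite_interp s t A B C E) t E.
Proof.
intros hst.
eapply is_derive_ext;
  [intros y; symmetry; apply hermite_interpE, hst |].
auto_derive; [lra | field; lra].
Qed.

(** * Derivatives within a set *)

Lemma is_derive_in_of_is_derive (D : R -> Prop) (f : R -> R) (x l : R) :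
  is_derive f x l -> is_derive_in D f x l.
Proof.
intros Hf; apply is_derive_Reals in Hf.
intros eps heps; destruct (Hf eps heps) as [d Hd].
exists d; split; [apply cond_pos |].
intros y [[_ hne] hy]; simpl in hy |- *; unfold Rdist in hy |- *.
replace (f y) with (f (x + (y - x))) by (f_equal; ring).
apply Hd; [lra | exact hy].
Qed.

Lemma is_derive_in_plus (D : R -> Prop) (f g : R -> R) (x l m : R) :
  is_derive_in D f x l -> is_derive_in D g x m ->
  is_derive_in D (fun y => f y + g y) x (l + m).
Proof. exact (Dadd D (fun _ => l) (fun _ => m) f g x). Qed.

(** A derivative within [D] only depends on the values on [D], provided that the
    base point belongs to [D]. *)
Lemma is_derive_in_ext (D : R -> Prop) (f g : R -> R) (x l : R) :
  D x -> (forall y, D y -> f y = g y) ->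
  is_derive_in D f x l -> is_derive_in D g x l.
Proof.
intros hx Hfg Hf eps heps; destruct (Hf eps heps) as [d [hd Hd]].
exists d; split; [exact hd |].
intros y hy; rewrite <- !Hfg; [exact (Hd y hy) | exact hx | apply hy].
Qed.

Lemma is_derive_in_derive_in (s t : R) (f : R -> R) (x : R) :
  s < t -> s <= x <= t ->
  differentiable_on (fun y => s <= y <= t) f ->
  is_derive_in (fun y => s <= y <= t) f x
    (derive_in (fun y => s <= y <= t) f x).
Proof.
intros hst hx Hf; destruct (Hf x hx) as [l Hl].
rewrite (derive_in_unique s t f x l hst hx Hl); exact Hl.
Qed.

(** * Correcting the endpoint data of a function *)

(** The Hermite correction of [g] is differentiable, with values [A], [B] and
    one-sided derivatives [C], [E] at the endpoints. *)
Lemma hermite_correction (s t A B C E : R) (g u : R -> R)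
    (D := fun y => s <= y <= t) :
  s < t -> differentiable_on D g ->
  (forall x, D x ->
     u x = g x + hermite_interp s t (A - g s) (B - g t)
                   (C - derive_in D g s) (E - derive_in D g t) x) ->
  differentiable_on D u /\ u s = A /\ u t = B /\
  derive_in D u s = C /\ derive_in D u t = E.
Proof.
intros hst Hg Hu.
assert (hs : D s) by (unfold D; lra).
assert (ht : D t) by (unfold D; lra).
set (p := hermite_interp _ _ _ _ _ _) in Hu.
assert (Hderiv : forall x l, D x -> is_derive p x l ->
          is_derive_in D u x (derive_in D g x + l)).
{ intros x l hx Hp.
  apply (is_derive_in_ext D (fun y => g y + p y)); [exact hx | |].
  - intros y hy; symmetry; exact (Hu y hy).
  - apply is_derive_in_plus; [| exact (is_derive_in_of_is_derive _ _ _ _ Hp)].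
    exact (is_derive_in_derive_in s t g x hst hx Hg). }
repeat split.
- intros x hx.
  destruct (ex_derive_hermite_interp s t (A - g s) (B - g t)
              (C - derive_in D g s) (E - derive_in D g t) x hst) as [l Hl].
  exists (derive_in D g x + l); exact (Hderiv x l hx Hl).
- rewrite (Hu s hs); unfold p; rewrite hermite_interp_left by exact hst; ring.
- rewrite (Hu t ht); unfold p; rewrite hermite_interp_right by exact hst; ring.
- apply (derive_in_unique s t); [exact hst | exact hs |].
  replace C with (derive_in D g s + (C - derive_in D g s)) by ring.
  apply Hderiv; [exact hs | apply is_derive_hermite_interp_left, hst].
- apply (derive_in_unique s t); [exact hst | exact ht |].
  replace E with (derive_in D g t + (E - derive_in D g t)) by ring.
  apply Hderiv; [exact ht | apply is_derive_hermite_interp_right, hst].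
Qed.

(** * The representation theorem *)

(** The data [v i] of the piece starting at node [i], completed at the last node
    [N], where no piece starts, by the data [w] of the piece ending at node [N]. *)
Definition nodal_data (N : nat) (v : nat -> R) (w : R) (i : nat) : R :=
  if Nat.eq_dec i N then w else v i.

Lemma nodal_data_start (N : nat) (v : nat -> R) (w : R) (i : nat) :
  (i < N)%nat -> nodal_data N v w i = v i.
Proof. intros hi; unfold nodal_data; destruct Nat.eq_dec; [lia | reflexivity]. Qed.

(** When the data [r i] at the right end of each piece agree with the data at the
    start of the next one, the nodal data are also those of the piece ending at
    the node. *)
Lemma nodal_data_end (N : nat) (v r : nat -> R) (i : nat) :
  (forall j, (j + 1 < N)%nat -> r j = v (j + 1)%nat) ->
  (i < N)%nat -> nodal_data N v (r (N - 1)%nat) (i + 1) = r i.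
Proof.
intros Hr hi; unfold nodal_data; destruct Nat.eq_dec as [e | e].
- f_equal; lia.
- symmetry; apply Hr; lia.
Qed.

Theorem theorem5 (N : nat) (a b : R) (X : nat -> R)
    (hN : (1 <= N)%nat)
    (hXa : X 0%nat = a) (hXb : X N = b)
    (hX : forall i, (i < N)%nat -> X i < X (i + 1)%nat) :
  (forall (g : nat -> R -> R) (alpha beta : nat -> R) (u : nat -> R -> R),
     (forall i, (i < N)%nat -> differentiable_on (Omega X i) (g i)) ->
     hermite_form N X g alpha beta u ->
     (forall i, (i < N)%nat -> differentiable_on (Omega X i) (u i)) /\
     C1_conditions N X u)
  /\
  (forall u : nat -> R -> R,
     (forall i, (i < N)%nat -> differentiable_on (Omega X i) (u i)) ->
     C1_conditions N X u ->
     exists (g : nat -> R -> R) (alpha beta : nat -> R),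
       (forall i, (i < N)%nat -> differentiable_on (Omega X i) (g i)) /\
       hermite_form N X g alpha beta u).
Proof.
split.
- intros g alpha beta u Hg Hu.
  assert (H : forall i, (i < N)%nat ->
    differentiable_on (Omega X i) (u i) /\
    u i (X i) = alpha i /\ u i (X (i + 1)%nat) = alpha (i + 1)%nat /\
    derive_in (Omega X i) (u i) (X i) = beta i /\
    derive_in (Omega X i) (u i) (X (i + 1)%nat) = beta (i + 1)%nat).
  { intros i hi.
    apply (hermite_correction (X i) (X (i + 1)%nat) _ _ _ _ (g i));
      [exact (hX i hi) | exact (Hg i hi) |].
    intros x hx; rewrite (Hu i x hi hx); unfold hermite_interp, Omega; ring. }
  split; [intros i hi; apply (H i hi) |].
  intros i hi.
  destruct (H i ltac:(lia)) as (_ & _ & Hval & _ & Hder).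
  destruct (H (i + 1)%nat hi) as (_ & Hval' & _ & Hder' & _).
  split; congruence.
- intros u Hu HC.
  exists u.
  exists (nodal_data N (fun i => u i (X i)) (u (N - 1)%nat (X (N - 1 + 1)%nat))).
  exists (nodal_data N (fun i => derive_in (Omega X i) (u i) (X i))
            (derive_in (Omega X (N - 1)) (u (N - 1)%nat) (X (N - 1 + 1)%nat))).
  split; [exact Hu |].
  intros i x hi _.
  do 2 rewrite (nodal_data_start N _ _ i) by exact hi.
  rewrite (nodal_data_end N _ (fun i => u i (X (i + 1)%nat)) i)
    by (try exact hi; intros j hj; apply (HC j hj)).
  rewrite (nodal_data_end N _
             (fun i => derive_in (Omega X i) (u i) (X (i + 1)%nat)) i)
    by (try exact hi; intros j hj; apply (HC j hj)).
  ring.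
Qed.
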